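(* Let $m,k,n$ be integers with $2\le m+2\le k<n$ and $2k\le n+m$. Then the map $\mathrm{cDes}_J:\mathrm{SYT}((n-k+m,k)/(m))\to 2^{[n]}$ defined by $\mathrm{cDes}_J(T)=\mathrm{cDes}(\mathrm{jdt}(T))$ is a cyclic descent map for the skew shape $(n-k+m,k)/(m)$.
   Context: Let $[n]=\{1,\dots,n\}$. Tableaux are drawn in English notation (row 1 on top), and $T_{i,j}$ is the entry in row $i$ and column $j$. For a skew shape $\lambda/\mu$ with $n$ cells, $\mathrm{SYT}(\lambda/\mu)$ is the set of standard Young tableaux of that shape; $\mathrm{Des}(T)=\{i\in[n-1]: i+1\text{ is in a lower row than } i\text{ in }T\}$. A cyclic descent map for $\lambda/\mu$ is a map $\mathrm{cDes}:\mathrm{SYT}(\lambda/\mu)\to 2^{[n]}$ such that (i) $\mathrm{cDes}(T)\cap[n-1]=\mathrm{Des}(T)$ for every $T$; and (ii) the multiset $\{\!\{\mathrm{cDes}(T):T\in\mathrm{SYT}(\lambda/\mu)\}\!\}$ is invariant under replacing each set $D$ by $1+D$ (adding $1$ modulo $n$ to each element). For a standard Young tableau $T$ of skew shape, $\mathrm{jdt}(T)$ is its rectification: the unique standard Young tableau of straight shape obtained from $T$ by a sequence of jeu de taquin slides. For $T\in\mathrm{SYT}((n-k+m,k)/(m))$ with $k\ge m+2$, $\mathrm{jdt}(T)$ has shape $(n-d,d)$ for some $2\le d\le n/2$. For $S\in\mathrm{SYT}(n-d,d)$ with $2\le d\le n/2$, the set $\mathrm{cDes}(S)$ is defined by $\mathrm{cDes}(S)\cap[n-1]=\mathrm{Des}(S)$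 and: $n\in\mathrm{cDes}(S)$ if and only if both (1) $S_{2,d}=S_{2,d-1}+1$ and (2) $S_{2,i-1}>S_{1,i}$ for every $1<i<d$. *)

(* Defs.v *)
From HB Require Import structures.
From mathcomp Require Import all_boot all_fingroup.

Set Implicit Arguments.
Unset Strict Implicit.
Unset Printing Implicit Defensive.

(** ** Tableaux *)

(* A filling of an r x c box, row 0 on top.  The value 0 marks a box that is
   not in the shape, so that tableaux of different (skew) shapes, such as a
   tableau and its rectification, live in the same type. *)
Definition tableau (r c n : nat) := {ffun 'I_r * 'I_c -> 'I_n.+1}.

(* The entry T_{i,j}, with rows and columns numbered from 1. *)
Definition entry (r c n : nat) (T : tableau r c n) (i j : nat) : nat :=
  if [pick p : 'I_r * 'I_c | (p.1.+1 == i) && (p.2.+1 == j)] is Some p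
  then T p else 0.

Definition row_size (r c n : nat) (T : tableau r c n) (i : nat) : nat :=
  #|[set p : 'I_r * 'I_c | (p.1.+1 == i) && (0 < T p)]|.

Definition in_skew (la mu : seq nat) (r c : nat) (p : 'I_r * 'I_c) : bool :=
  nth 0 mu p.1 <= p.2 < nth 0 la p.1.

Definition is_syt (la mu : seq nat) (n : nat)
    (T : tableau (size la) (head 0 la) n) : bool :=
  [&& [forall p, (0 < T p) == in_skew la mu p],
      [forall v : 'I_n.+1, (0 < v) ==> (#|[set p | T p == v]| == 1)],
      [forall p, forall q,
         [&& in_skew la mu p, in_skew la mu q, p.1 == q.1 & p.2 < q.2]
           ==> (T p < T q)]
    & [forall p, forall q,
         [&& in_skew la mu p, in_skew la mu q, p.2 == q.2 & p.1 < q.1]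
           ==> (T p < T q)]].

(* SYT(la/mu), for partitions mu inside la with |la/mu| = n (partitions are
   given by their lists of parts; missing parts of mu are 0). *)
Definition SYT (n : nat) (la mu : seq nat) :=
  {T : tableau (size la) (head 0 la) n | @is_syt la mu n T}.

(** ** Subsets of [n] and descents *)

(* The ordinal i : 'I_n stands for the element i + 1 of [n] = {1, ..., n}. *)

Definition Des (r c n : nat) (T : tableau r c n) : {set 'I_n} :=
  [set i : 'I_n | [exists p, exists q,
     [&& T p == i.+1 :> nat, T q == i.+2 :> nat & p.1 < q.1]]].

Definition below_n (n : nat) : {set 'I_n} := [set i : 'I_n | i.+1 < n].

(* 1 + D, modulo n *)
Definition shift (n : nat) (D : {set 'I_n}) : {set 'I_n} :=
  [set ordS i | i in D].

Definition cyclic_descent_map (n : nat) (la mu : seq nat)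
    (cDes : SYT n la mu -> {set 'I_n}) : Prop :=
  (forall T, cDes T :&: below_n n = Des (val T)) /\
  perm_eq [seq shift (cDes T) | T : SYT n la mu]
          [seq cDes T | T : SYT n la mu].

(** ** Jeu de taquin *)

Definition right_or_below (r c : nat) (p q : 'I_r * 'I_c) : bool :=
  ((q.1 == p.1 :> nat) && (q.2 == p.2.+1 :> nat)) ||
  ((q.1 == p.1.+1 :> nat) && (q.2 == p.2 :> nat)).

(* The box whose entry moves into the hole p: among the nonempty boxes right
   of p and below p, the one with the smaller entry. *)
Definition jdt_next (r c n : nat) (T : tableau r c n) (p : 'I_r * 'I_c) :
    option ('I_r * 'I_c) :=
  [pick q | [&& right_or_below p q, 0 < T q
     & [forall q', right_or_below p q' && (0 < T q') ==> (T q <= T q')]]].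

(* As the hole contains 0, moving an entry into it swaps two values. *)
Definition swap_boxes (r c n : nat) (T : tableau r c n) (p q : 'I_r * 'I_c) :
    tableau r c n :=
  [ffun x => T (tperm p q x)].

Fixpoint slide_loop (r c n fuel : nat) (T : tableau r c n)
    (p : 'I_r * 'I_c) : tableau r c n :=
  if fuel is fuel'.+1 then
    if jdt_next T p is Some q then slide_loop fuel' (swap_boxes T p q) q else T
  else T.

(* The hole moves right or down at each step, so r + c steps are enough. *)
Definition slide (r c n : nat) (T : tableau r c n) (p : 'I_r * 'I_c) :
    tableau r c n :=
  slide_loop (r + c) T p.

(* Rectification of a tableau of inner shape mu: slide into the boxes of mu in
   reverse reading order (enum lists boxes row by row, from left to right), so
   that each box is a corner of what remains of mu.  The result does not
   depend on the order; if mu has one row, no other order is possible. *)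
Definition jdt (mu : seq nat) (r c n : nat) (T : tableau r c n) :
    tableau r c n :=
  foldl (@slide r c n) T
    (rev (enum [pred p : 'I_r * 'I_c | p.2 < nth 0 mu p.1])).

(** ** Cyclic descents of two-row tableaux *)

Definition n_is_cdes (r c n : nat) (S : tableau r c n) : bool :=
  let d := row_size S 2 in
  (entry S 2 d == (entry S 2 d.-1).+1) &&
  all (fun i => entry S 1 i < entry S 2 i.-1) (index_iota 2 d).

(* Meant for S of straight shape (n - d, d) with 2 <= d. *)
Definition cDes (r c n : nat) (S : tableau r c n) : {set 'I_n} :=
  Des S :|: [set i : 'I_n | (i.+1 == n) && n_is_cdes S].

Definition cDesJ (n : nat) (la mu : seq nat) (T : SYT n la mu) : {set 'I_n} :=
  cDes (jdt mu (val T)).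

(* Main.v *)
Require Import Defs.
From mathcomp Require Import all_boot all_fingroup zify.

(** A two-row tableau is the word of its entries 1, ..., n, with the letter true
    for an entry in the second row.  For the shape (n - k + m, k) / (m) the
    words that occur are the paths (false = up, true = down) with k downs that
    start at height m and never go below 0: this is [ballot m].

    Jeu de taquin.  Seen as parentheses, each down closes an earlier up or is
    unmatched.  A slide into column h + 1 of the first row turns the first
    down at which the path started at h goes below 0 into an up
    ([slide_rows_positions]), so that the m slides of the rectification turn
    every unmatched down into an up: [jdt] becomes [rectify 0].  This preserves
    descents.  A ballot word S with d downs comes from exactly one word
    with k downs, by turning its first k - d unmatched ups into downs, as soon
    as d <= k <= n - d; and that word is [ballot m] iff k <= m + d
    ([nwords_rectify]).  The theorem thus follows from its analogue for each
    straight shape (n - d, d) with 2 <= d <= n / 2 ([nwords_skew_rot]).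

    Straight shapes.  Let M_d(E) be the number of all words with d downs and
    cyclic descent set E, where n counts as a cyclic descent when the last
    letter is up and the first one down.  Rotating words shows that M_d(E) does
    not change when E is rotated.  The number of ballot words with d downs
    and cyclic descent set E is M_d(E) - M_(d-1)(E) ([nwords_ballot_cdes]),
    hence is rotation invariant as well.  Two facts give this difference.
    - For linear descent sets, rectification shows that the words with d downs
      exceed those with d - 1 downs by the ballot words with d downs
      ([nwords_ballot_descents]).
    - For the sets E that contain n, deleting the down at the start and the up
      at the end gives words of length n - 2.  On the ballot side, the
      condition for n to be a cyclic descent of S says that S is an up
      followed by a ballot word of length n - 2 whose last down has been
      doubled ([ballot_doubled]).  So the previous fact for length n - 2 and
      d - 1 downs applies.
    The sets that do not contain n are obtained by subtraction. *)

Set Implicit Arguments.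
Unset Strict Implicit.
Unset Printing Implicit Defensive.

(** * Ballot words and rectification *)

(** The path of a word started at height [h], where [true] is a down step,
    stays nonnegative. *)
Fixpoint ballot (h : nat) (w : bitseq) : bool :=
  if w is x :: w' then
    if x then (0 < h) && ballot h.-1 w' else ballot h.+1 w'
  else true.

(** Turns into an up step each down step that would take the path below 0; the
    path then waits at height 0.  The downs flipped by [rectify 0] are the
    unmatched ones. *)
Fixpoint rectify (h : nat) (w : bitseq) : bitseq :=
  if w is x :: w' then
    if x then (0 < h) :: rectify h.-1 w' else false :: rectify h.+1 w'
  else [::].

(** Inverse of [rectify h] on words with [k] downs.  An up step at height 0 is
    unmatched iff the path never comes back to 0, which is the test
    [ballot 0 w'].  Unmatched ups become downs as long as the rest of the word
    has fewer downs than required. *)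
Fixpoint unrectify (h k : nat) (w : bitseq) : bitseq :=
  if w is x :: w' then
    if x then true :: unrectify h.-1 k.-1 w'
    else if [&& h == 0, ballot 0 w' & count id w' < k]
      then true :: unrectify 0 k.-1 w'
      else false :: unrectify h.+1 k w'
  else [::].

Lemma size_rectify h w : size (rectify h w) = size w.
Proof. by elim: w h => [|[] w IH] h //=; rewrite IH. Qed.

Lemma size_unrectify h k w : size (unrectify h k w) = size w.
Proof.
by elim: w h k => [|[] w IH] h k //=; rewrite ?IH //; case: ifP; rewrite /= IH.
Qed.

Lemma ballotS h w : ballot h w -> ballot h.+1 w.
Proof.
elim: w h => [|[] w IH] [|h] //=; first by move/IH.
  by move/IH.
by move/IH.
Qed.

Lemma ballot_size h w : size w <= h -> ballot h w.
Proof.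
elim: w h => [|[] w IH] h //= lewh; last by apply: IH; lia.
by apply/andP; split; [lia | apply: IH; lia].
Qed.

Lemma ballot_rectify h w : ballot h (rectify h w).
Proof. by elim: w h => [|[] w IH] [|h] //=; exact: ballotS. Qed.

Lemma rectify_id h w : ballot h w -> rectify h w = w.
Proof.
elim: w h => [|[] w IH] h //=; last by move/IH->.
by case/andP=> -> /IH ->.
Qed.

(** A flip can only happen at height 0, and a path started strictly below has by
    then gone below 0. *)
Lemma rectify_id_lt h h' w : h' < h -> ballot h' (rectify h w) -> rectify h w = w.
Proof.
elim: w h h' => [|[] w IH] h h' //= lth; last first.
  by move/(IH h.+1 h'.+1 lth)->.
have h_gt0 : 0 < h by lia.
by rewrite h_gt0 /= => /andP[h'0 /IH ->] //; lia.
Qed.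

(** The downs flipped from the start [h] are among those flipped from a lower
    start; this makes successive slides compose to one rectification. *)
Lemma rectify_rectify h h' w : h' <= h -> rectify h' (rectify h w) = rectify h' w.
Proof.
elim: w h h' => [|[] w IH] h h' leh //=; last by rewrite IH.
case: h leh => [|h] leh /=; last by rewrite IH //; lia.
have -> : h' = 0 by lia.
by rewrite /= (rectify_id (ballotS (ballot_rectify 0 w))).
Qed.

Lemma count_rectify_leq h w : count id (rectify h w) <= count id w.
Proof.
elim: w h => [|[] w IH] h //=; last exact: IH.
 have := IH h.-1; case: (0 < h); lia.
Qed.

(** Each down kept by [rectify h] is matched by an up or by one of the [h] initial
    units of height; the flipped downs are neither kept nor ups. *)
Lemma count_rectify_sum h w : count id w + count id (rectify h w) <= h + size w.
Proof.
elim: w h => [|[] w IH] h //=; last by have := IH h.+1; lia.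
by case: h => [|h] /=; [have := IH 0 | have := IH h]; lia.
Qed.

(** Each flip of [rectify h] records a new minimum of the path, so a start
    higher by [m] avoids negative heights iff there are at most [m] flips. *)
Lemma ballot_rectifyE h m w :
  ballot (h + m) w = (count id w <= m + count id (rectify h w)).
Proof.
elim: w h m => [|[] w IH] h m /=; first by rewrite leq0n.
  case: h => [|h] /=; last by rewrite IH; lia.
  case: m => [|m] /=; last by rewrite (IH 0 m); lia.
  by have := count_rectify_leq 0 w; lia.
by rewrite -addSn IH; lia.
Qed.

Lemma rectifyK h w : unrectify h (count id w) (rectify h w) = w.
Proof.
elim: w h => [|[] w IH] h //=.
  case: h => [|h] /=; last by rewrite IH.
  by rewrite ballot_rectify IH (leq_ltn_trans (count_rectify_leq 0 w)).
rewrite IH; case: eqP => //= ->.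
case: ifP => // /andP[b]; suff -> : rectify 1 w = w by rewrite ltnn.
exact: rectify_id_lt b.
Qed.

(** The last hypothesis is the invariant of the recursion: at positive height the
    pending ups must be matched by later downs, unless no flip is left to do. *)
Lemma unrectifyK h k w :
    ballot h w -> count id w <= k -> k + count id w <= h + size w ->
    (0 < h -> ballot h.-1 w -> k = count id w) ->
  rectify h (unrectify h k w) = w /\ count id (unrectify h k w) = k.
Proof.
elim: w h k => [|[] w IH] h k /=.
- by move=> _ _ le2 H; split=> //; case: h le2 H => [|h] le2 H; [lia | rewrite H].
- case/andP=> h0 b lek le2 H.
  have [] := IH h.-1 k.-1 b; try lia.
  by move=> -> ->; rewrite h0; split=> //; lia.
- move=> b lek le2 H; case: ifP => [/and3P[/eqP h0 b0 ltk]|flip] /=.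
    subst h; have [] := IH 0 k.-1 b0; try lia.
    by move=> -> ->; split=> //; lia.
  have [] := IH h.+1 k b; try lia; last by move=> -> ->.
  move=> _ /= b'; case: (posnP h) => [h0|h0].
    by move: flip; rewrite h0 /= in b' *; rewrite b' /=; lia.
  by apply: H => //; rewrite prednK.
Qed.

Lemma ballot_nseq h y : ballot h (nseq y false).
Proof. by elim: y h => //=. Qed.

Lemma ballot_cat h v w :
  ballot h (v ++ w) =
  ballot h v && ballot (h + count negb v - count id v) w.
Proof.
elim: v h => [|[] v IH] h /=; first by rewrite addn0 subn0.
  rewrite IH -andbA; case: h => //= h; congr (_ && ballot _ _); lia.
by rewrite IH; congr (_ && ballot _ _); lia.
Qed.

(** * Descents of a word *)

(** The bit at position [i] (from 0) tells whether the letter there is a [true]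
    preceded by a [false]; [p] is the letter before the word.  As entries are
    numbered from 1, this bit stands for the descent [i]. *)
Fixpoint descents (p : bool) (w : bitseq) : bitseq :=
  if w is x :: w' then (~~ p && x) :: descents x w' else [::].

Lemma size_descents p w : size (descents p w) = size w.
Proof. by elim: w p => [|x w IH] p //=; rewrite IH. Qed.

(** A flipped down happens at height 0, where the preceding letter is a down or
    absent, so no descent ends there.  The letter after it is an up or a flipped
    down, so that turning it into an up creates no descent. *)
Lemma descents_rectify_gen h p q w : (h = 0 -> p = true) -> (0 < h -> p = q) ->
  descents q (rectify h w) = descents p w.
Proof.
elim: w h p q => [|[] w IH] h p q //= Hp Hq.
  case: h Hp Hq => [|h] Hp Hq /=.
    by rewrite Hp // andbF (IH 0 true false).
  by rewrite Hq // (IH _ true true).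
by rewrite !andbF (IH _ false false).
Qed.

Lemma descents_rectify w : descents true (rectify 0 w) = descents true w.
Proof. exact: descents_rectify_gen. Qed.

Lemma descents_nseq p y : descents p (nseq y false) = nseq y false.
Proof. by elim: y p => //= y IH p; rewrite andbF IH. Qed.

Lemma descents_rcons p w x : descents p (rcons w x) = rcons (descents p w) (~~ last p w && x).
Proof. by elim: w p => //= z w IH p; rewrite IH. Qed.

Lemma nth_descents p w i : nth false (descents p w) i.+1 = ~~ nth true w i && nth false w i.+1.
Proof.
elim: w p i => [|x w IH] p [|i] //=.
by case: w {IH} => [|y w] //=; rewrite andbF.
Qed.

(** * Positions of the letters *)

(** With [s = 1] these are the entries of one row of the tableau of the word:
    row 1 for [b = false], row 2 for [b = true]. *)
Fixpoint positions (s : nat) (b : bool) (w : bitseq) : seq nat :=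
  if w is x :: w' then
    if x == b then s :: positions s.+1 b w' else positions s.+1 b w'
  else [::].

Lemma size_positions s b w : size (positions s b w) = count (pred1 b) w.
Proof. by elim: w s => [|x w IH] s //=; case: eqP => _ /=; rewrite IH. Qed.

Lemma size_positions_true s w : size (positions s true w) = count id w.
Proof. by rewrite size_positions; apply: eq_count; case. Qed.

Lemma size_positions_false s w : size (positions s false w) = size w - count id w.
Proof.
rewrite size_positions -(count_predC id w) addKn; apply: eq_count; by case.
Qed.

Lemma mem_positions s b w i :
  (i \in positions s b w) = (s <= i < s + size w) && (nth (~~ b) w (i - s) == b).
Proof.
elim: w s => [|x w IH] s /=; first by rewrite in_nil addn0; lia.
have -> : (i \in (if x == b then s :: positions s.+1 b w else positions s.+1 b w)) =
    (i == s) && (x == b) || (i \in positions s.+1 b w).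
  by case: (x == b); rewrite ?inE ?andbT ?andbF.
rewrite IH; case: (ltngtP i s) => [lt|gt|->] /=.
- by apply/esym/negbTE; lia.
- have -> : i - s = (i - s.+1).+1 by lia.
  by rewrite addSnnS.
- by rewrite subnn /= orbF; case: (x == b) => //=; lia.
Qed.

Lemma positions_sorted s b w : sorted ltn (positions s b w).
Proof.
elim: w s => [|x w IH] s //=; case: ifP => // _.
rewrite /= path_min_sorted //; apply/allP => i; rewrite mem_positions /=.
by case/andP=> /andP[].
Qed.

Lemma nth_positions_bounds s b w i :
  i < size (positions s b w) -> s <= nth 0 (positions s b w) i < s + size w.
Proof. by move/(mem_nth 0); rewrite mem_positions => /andP[]. Qed.

(** The column condition of the two-row skew tableau: the path is negative after
    the [h + i]-th down (from 0) iff fewer than [i + 1] ups precede it. *)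
Lemma ballotP h s w :
  reflect (forall i, h + i < count id w ->
     i < size (positions s false w) /\
     nth 0 (positions s false w) i < nth 0 (positions s true w) (h + i))
    (ballot h w).
Proof.
elim: w h s => [|[] w IH] h s /=.
- by apply: ReflectT => i; rewrite ltn0.
- case: h => [|h] /=.
    apply: ReflectF => /(_ 0 isT) [/nth_positions_bounds /= H].
    by lia.
  apply: (iffP (IH h s.+1)) => H i /=; rewrite ?addSn ?add1n ?ltnS => /H //.
- apply: (iffP (IH h.+1 s.+1)) => H i.
  + case: i => [|i] /=; rewrite ?addnS /=.
      move=> lt; split=> //; rewrite addn0 in lt *.
      have := @nth_positions_bounds s.+1 true w h; rewrite size_positions_true => /(_ lt).
      by lia.
    by move=> lt; have [] := H i; rewrite ?addSn.
  + move=> lt; have [] := H i.+1; first by rewrite addnS -addSn.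
    by rewrite /= addnS.
Qed.

Lemma positions_cat s b v w : positions s b (v ++ w) = positions s b v ++ positions (s + size v) b w.
Proof.
elim: v s => [|x v IH] s /=; first by rewrite addn0.
by rewrite IH addnS -addSn; case: ifP.
Qed.

Lemma positions_true_nseq s y : positions s true (nseq y false) = [::].
Proof. by elim: y s => //=. Qed.

Lemma mem_positions1 b w v : 0 < v -> (v \in positions 1 b w) = (nth (~~ b) w v.-1 == b).
Proof.
move=> v0; rewrite mem_positions v0 add1n subn1 /=; case: ltnP => //= le.
by rewrite nth_default; [case: b | lia].
Qed.

(** * Counting words *)

(** Words are handled as sequences with a separate length, because the
    bijections below change the length. *)
Definition nwords (n : nat) (P : pred bitseq) : nat :=
  #|[set w : n.-tuple bool | P w]|.

Lemma eq_nwords n (P Q : pred bitseq) :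
  (forall w, size w = n -> P w = Q w) -> nwords n P = nwords n Q.
Proof.
by move=> e; apply: eq_card => w; rewrite !inE e // size_tuple.
Qed.

Lemma nwords_split (Q : pred bitseq) n (P : pred bitseq) :
  nwords n P = nwords n (predI P Q) + nwords n (predI P (predC Q)).
Proof.
rewrite /nwords -(cardsID [set w : n.-tuple bool | Q w]); congr (_ + _);
  apply: eq_card => w; rewrite !inE //=.
by rewrite andbC.
Qed.

Lemma nwords_bij (g : bitseq -> bitseq) n1 n2 (P Q : pred bitseq) :
    (forall w, size w = n1 -> P w -> size (g w) = n2 /\ Q (g w)) ->
    {in [pred w | (size w == n1) && P w] &, injective g} ->
    (forall w, size w = n2 -> Q w ->
      exists v, [/\ size v = n1, P v & g v = w]) ->
  nwords n1 P = nwords n2 Q.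
Proof.
move=> gP gI gS; rewrite /nwords.
pose G (w : n1.-tuple bool) : n2.-tuple bool := insubd [tuple of nseq n2 true] (g w).
have GE (w : n1.-tuple bool) : P w -> G w = g w :> bitseq.
  move=> Pw; rewrite val_insubd; have [-> _] := gP w (size_tuple w) Pw.
  by rewrite eqxx.
rewrite -(card_in_imset (f := G)) => [|u v]; last first.
  rewrite !inE => Pu Pv /(congr1 val) /=; rewrite !GE // => /gI e.
  by apply: val_inj; apply: e; rewrite inE /= size_tuple eqxx.
apply: eq_card => w; rewrite inE; apply/imsetP/idP => [[v]|Qw].
  by rewrite inE => Pv ->; rewrite GE //; have [] := gP v (size_tuple v) Pv.
have [v [sv Pv gv]] := gS w (size_tuple w) Qw.
have sv' : size v == n1 by apply/eqP.
by exists (Tuple sv'); [rewrite inE | apply: val_inj; rewrite /= GE].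
Qed.

(** A ballot word with [d] downs has [n - 2 d] unmatched ups, and [k - d] of
    them, the first ones, have to become downs again.  Hence the bound
    [k + d <= n]. *)
Lemma nwords_rectify (F : pred bitseq) n m k :
  nwords n (fun w => [&& ballot m w, count id w == k & F (rectify 0 w)]) =
  nwords n (fun w => [&& ballot 0 w, count id w <= k <= m + count id w,
                         k + count id w <= n & F w]).
Proof.
apply: (nwords_bij (g := rectify 0)) => [w sw /and3P[b /eqP ck Fw]|u v|w sw].
- split; first by rewrite size_rectify.
  rewrite ballot_rectify Fw andbT -ck count_rectify_leq /=.
  rewrite -(add0n m) ballot_rectifyE in b; rewrite b /=.
  by have := count_rectify_sum 0 w; lia.
- rewrite !inE => /and4P[_ _ /eqP cu _] /and4P[_ _ /eqP cv _] e.
  by rewrite -(rectifyK 0 u) -(rectifyK 0 v) cu cv e.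
- case/and4P=> b /andP[le1 le2] le3 Fw; exists (unrectify 0 k w).
  have [|//|e ce] := unrectifyK b le1; first by rewrite add0n sw.
  rewrite size_unrectify e ce eqxx Fw andbT; split=> //.
  by rewrite andbT -[m]add0n ballot_rectifyE ce e.
Qed.

Lemma nwords_cons_split (f : bitseq -> bitseq) (P : pred bitseq) n E :
    (forall w, size w = n -> size (f w) = (size E).+1) ->
  nwords n (fun w => P w && (behead (f w) == E)) =
  nwords n (fun w => P w && (f w == true :: E)) +
  nwords n (fun w => P w && (f w == false :: E)).
Proof.
move=> sf; rewrite (nwords_split (fun w => head false (f w))); congr (_ + _);
  apply: eq_nwords => w /sf /=; case: (f w) => // b l _ /=;
  by rewrite eqseq_cons; case: b; rewrite /= ?andbT ?andbF.
Qed.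

Lemma nwords_by_count n (P : pred bitseq) :
  nwords n P = \sum_(d < n.+1) nwords n (fun w => P w && (count id w == d)).
Proof.
pose f (w : n.-tuple bool) : 'I_n.+1 := inord (count id w).
rewrite /nwords -sum1_card (partition_big f predT) //=.
apply: eq_bigr => d _; rewrite -sum1_card; apply: eq_bigl => w.
rewrite !inE -val_eqE /= inordK // ltnS.
by rewrite -[n in _ <= n](size_tuple w) count_size.
Qed.

(** * Doubling the last letter *)

Lemma count_nseq_false y : count id (nseq y false) = 0.
Proof. by rewrite count_nseq mul0n. Qed.

Lemma descents_double p v y :
  descents p (v ++ [:: true, true & nseq y false]) =
  rcons (descents p (v ++ true :: nseq y false)) false.
Proof.
elim: v p => [|x v IH] p /=; last by rewrite IH.
by rewrite !descents_nseq -cats1 /= -[[:: false]]/(nseq 1 false) -nseqD addn1.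
Qed.

(** The condition [n_is_cdes], read on the rows of positions of a word. *)
Definition word_n_is_cdes (w : bitseq) : bool :=
  let d := count id w in
  (nth 0 (positions 1 true w) d.-1 == (nth 0 (positions 1 true w) d.-2).+1) &&
  all (fun i => nth 0 (positions 1 false w) i.-1 < nth 0 (positions 1 true w) i.-2)
    (index_iota 2 d).

Lemma last_trueP w : 0 < count id w ->
  exists v y, w = v ++ true :: nseq y false.
Proof.
elim: w => //= x w IH; case: (posnP (count id w)) => [w0|/IH [v [y ->]] _].
  case: x => /=; last by rewrite w0.
  move=> _; exists [::], (size w) => /=; congr (_ :: _).
  by elim: w w0 {IH} => //= -[] //= w IH /IH {1}->.
by exists (x :: v), y.
Qed.

(** Adjacent values in the last two cells of row 2 mean that the last two downs are
    consecutive letters. *)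
Lemma last_two_adjacentP s w : 1 < count id w ->
  nth 0 (positions s true w) (count id w).-1 =
    (nth 0 (positions s true w) (count id w).-2).+1 ->
  exists v y, w = v ++ [:: true, true & nseq y false].
Proof.
move=> c2; have /last_trueP [v [y ew]] : 0 < count id w by lia.
move: c2; rewrite {}ew count_cat /= count_nseq_false addn0 addn1 ltnS.
move/last_trueP => [u [z ->]].
rewrite !count_cat /= count_nseq_false addn0 !positions_cat /= positions_true_nseq.
rewrite positions_true_nseq addn1 /= !size_cat /= size_nseq.
rewrite -catA !nth_cat !size_positions_true ltnn subnn ltnNge leqnSn /=.
rewrite subSnn /= => e; exists u, y.
have -> : z = 0 by lia.
by rewrite /= -catA.
Qed.

(** With [d] the number of downs of [S], the condition on the first [d - 2] of
    them says that the path of [v] is ballot even without the initial up.  The two last downs bring the path of [S] from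
    height [h + 1] to [h - 1], where [h] is the final height of [v]; this is
    nonnegative iff the single last down on the right does not go below 0. *)
Lemma ballot_doubled v y :
  let S := false :: v ++ [:: true, true & nseq y false] in
  ballot 0 S && word_n_is_cdes S = ballot 0 (v ++ true :: nseq y false).
Proof.
move=> S; rewrite /S /= !ballot_cat /= !ballot_nseq !andbT.
rewrite /word_n_is_cdes /= !positions_cat /= positions_true_nseq.
rewrite count_cat /= count_nseq_false !add0n.
set c := count id v; set e := count negb v.
have -> : c + (1 + (1 + 0)) = c.+2 by lia.
have c1c : (c.+1 < c) = false by lia.
rewrite /= !nth_cat !size_positions_true -/c ltnn subnn subSnn c1c /= eqxx /=.
have [lt|ge] := ltnP c e; last first.
  by rewrite !andbA; apply/idP/idP; [case/andP => /andP[_]; lia | case/andP; lia].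
have -> : 0 < 1 + e - c by lia.
have -> : 0 < (1 + e - c).-1 by lia.
have -> : 0 < e - c by lia.
rewrite !andbT.
have sA : size (positions 2 false v) = e.
  by rewrite size_positions; apply: eq_count; case.
apply/idP/idP => [/andP[_ /allP H]|b].
  apply/(ballotP _ 2) => i; rewrite add0n -/c => lti; rewrite sA; split; first lia.
  have := H i.+2; rewrite mem_index_iota /= => /(_ _).
  rewrite !nth_cat sA size_positions_true -/c lti; have -> : i < e by lia.
  by apply; lia.
rewrite (ballotS b) /=; apply/allP => i; rewrite mem_index_iota.
case: i => [|[|i]] //; rewrite !ltnS /= => lti.
rewrite !nth_cat sA size_positions_true -/c lti; have -> : i < e by lia.
by have [] := elimT (ballotP 0 2 v) b i; rewrite -/c.
Qed.

Fixpoint double_last (w : bitseq) : bitseq :=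
  if w is x :: w' then
    if true \in w' then x :: double_last w' else [:: x, x & w']
  else [::].

Lemma mem_true_nseq y : (true \in nseq y false) = false.
Proof. by rewrite mem_nseq andbF. Qed.

Lemma double_lastE v y : double_last (v ++ true :: nseq y false) =
  v ++ [:: true, true & nseq y false].
Proof.
elim: v => [|x v /= ->] /=; first by rewrite mem_true_nseq.
by rewrite mem_cat inE eqxx orbT.
Qed.

Lemma double_last_inj : {in [pred w | 0 < count id w] &, injective double_last}.
Proof.
(* The inverse deletes the last [true]. *)
pose halve := fix halve (w : bitseq) : bitseq :=
  if w is x :: w' then if true \in w' then x :: halve w' else w' else [::].
apply: (can_in_inj (g := halve)) => w /last_trueP [v [y ->]].
rewrite double_lastE; elim: v => [|x v /= ->] /=; first by rewrite mem_true_nseq.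
by rewrite mem_cat inE eqxx orbT.
Qed.

(** * Rotation invariance for words *)

(** Position 0 of the bit sequence stands for [n], which is congruent to 0.  The
    last letter is thus the one that cyclically precedes the first. *)
Definition cyclic_descents (w : bitseq) : bitseq := descents (last true w) w.

(** Same convention at position 0: it carries the membership of [n]. *)
Definition ballot_cdes (w : bitseq) : bitseq :=
  word_n_is_cdes w :: behead (descents true w).

(** Words with at most half downs rectify bijectively onto ballot words with at
    most as many downs, so the difference between the counts for [d] and
    [d - 1] consists of the ballot words with exactly [d] downs. *)
Lemma nwords_ballot_descents (F : pred bitseq) n d :
    (forall w, F (rectify 0 w) = F w) -> 0 < d -> 2 * d <= n ->
  nwords n (fun w => [&& ballot 0 w, count id w == d & F w]) +
  nwords n (fun w => (count id w == d.-1) && F w) =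
  nwords n (fun w => (count id w == d) && F w).
Proof.
move=> FE d0 dn.
have all_rect c : 2 * c <= n -> nwords n (fun w => (count id w == c) && F w) =
    nwords n (fun w => [&& ballot 0 w, count id w <= c & F w]).
  (* Every word of length [n] is ballot from height [n]. *)
  move=> cn; transitivity
    (nwords n (fun w => [&& ballot n w, count id w == c & F (rectify 0 w)])).
    by apply: eq_nwords => w sw; rewrite FE ballot_size ?sw.
  rewrite nwords_rectify; apply: eq_nwords => w sw; case: (ballot 0 w) => //=.
  by case: (F w); rewrite ?andbF ?andbT //; apply/idP/idP; lia.
rewrite !all_rect //; try lia.
rewrite [RHS](nwords_split (fun w => count id w == d)); congr (_ + _);
  apply: eq_nwords => w _ /=; case: (ballot 0 w); case: (F w) => //=; lia.
Qed.

(** A cyclic descent at the end means that the word is a down, any word, an up. *)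
Lemma nwords_cyclic_wrap n c E :
  nwords n.+2 (fun w => (count id w == c.+1) && (cyclic_descents w == true :: E)) =
  nwords n (fun w => (count id w == c) && (rcons (descents true w) false == E)).
Proof.
symmetry; apply: (nwords_bij (g := fun v => true :: rcons v false)).
- move=> v sv /andP[/eqP cv /eqP eE]; rewrite /= size_rcons sv; split=> //.
  by rewrite /cyclic_descents -cats1 /= count_cat /= cv !addn0 add1n eqxx cats1 last_rcons
    descents_rcons andbF eE /=.
- by move=> u v _ _ [] /rcons_inj [].
- case=> [|x w] // [sw] /andP[].
  case/lastP: w sw => [|v y] //; rewrite size_rcons => -[sv].
  rewrite /cyclic_descents -cats1 /= count_cat /= cats1 last_rcons => cv.
  case: x cv => /=; last by rewrite andbF.
  case: y => //= cv; rewrite descents_rcons andbF => /eqP[eE].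
  exists v; split=> //; rewrite eE eqxx andbT; lia.
Qed.

(** The bijection puts an up before the ballot word and doubles its last down.
    This shifts descents by one and adds a final position without descent,
    exactly as the outer letters do in [nwords_cyclic_wrap]. *)
Lemma nwords_ballot_n_cdes n c E : 0 < c ->
  nwords n.+2 (fun w => [&& ballot 0 w, count id w == c.+1
                         & ballot_cdes w == true :: E]) =
  nwords n (fun w => [&& ballot 0 w, count id w == c
                      & rcons (descents true w) false == E]).
Proof.
move=> c0; symmetry.
have desE v y : ballot 0 (v ++ true :: nseq y false) ->
  behead (descents true (false :: v ++ [:: true, true & nseq y false])) =
  rcons (descents true (v ++ true :: nseq y false)) false.
  by case: v => [|[] v] //= _; rewrite !descents_double.
apply: (nwords_bij (g := fun v => false :: double_last v)).
- move=> w sw /and3P[b /eqP cw /eqP eE].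
  have /last_trueP [v [y ew]] : 0 < count id w by rewrite cw.
  move: sw b cw eE; rewrite {}ew => sw b cw eE.
  move: sw cw; rewrite double_lastE /= !size_cat !count_cat /= => sw cw.
  split; first lia.
  have := ballot_doubled v y; rewrite b => /andP[/= -> nc].
  rewrite /ballot_cdes nc desE // eE eqxx andbT /=; apply/eqP; lia.
- move=> u v; rewrite !inE => /and4P[_ _ /eqP cu _] /and4P[_ _ /eqP cv _] [].
  by apply: double_last_inj; rewrite inE ?cu ?cv.
- move=> w sw /and3P[b /eqP cw /eqP [nc eE]].
  case: w sw b cw nc eE => [|[] w] // [sw] b /= cw nc eE.
  have [||v [y ew]] := @last_two_adjacentP 2 w; first lia.
    by case/andP: nc; rewrite /= add0n => /eqP.
  move: sw b cw nc eE; rewrite {}ew => sw b cw nc eE.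
  have b' : ballot 0 (v ++ true :: nseq y false) by rewrite -ballot_doubled b nc.
  exists (v ++ true :: nseq y false); rewrite double_lastE b'.
  rewrite -[descents false _]/(behead (descents true (false :: _))) desE // in eE.
  rewrite eE eqxx andbT; move: sw cw.
  rewrite !size_cat !count_cat /= => sw cw; split => //; lia.
Qed.

(** For [E] containing [n] both sides reduce to linear descent counts in length
    [n - 2].  The linear count in length [n] adds the cases where [n] is and is
    not in the set, so the other case follows. *)
Lemma nwords_ballot_cdes n d E : 1 < d -> 2 * d <= n -> size E = n ->
  nwords n (fun w => [&& ballot 0 w, count id w == d & ballot_cdes w == E]) +
  nwords n (fun w => (count id w == d.-1) && (cyclic_descents w == E)) =
  nwords n (fun w => (count id w == d) && (cyclic_descents w == E)).
Proof.
case: d => [|[|d]] // _; case: n => [|[|n]] //; try lia.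
case: E => [|b E] // dn [sE].
have trueE : nwords n.+2 (fun w => [&& ballot 0 w, count id w == d.+2
                                    & ballot_cdes w == true :: E]) +
  nwords n.+2 (fun w => (count id w == d.+1) && (cyclic_descents w == true :: E)) =
  nwords n.+2 (fun w => (count id w == d.+2) && (cyclic_descents w == true :: E)).
  rewrite nwords_ballot_n_cdes // !nwords_cyclic_wrap.
  apply: (nwords_ballot_descents (F := fun w => rcons (descents true w) false == E)) => //.
    by move=> w; rewrite descents_rectify.
  by lia.
(* The sets without [n]: subtract [trueE] from the linear count. *)
case: b => //.
have FE w : (behead (descents true (rectify 0 w)) == E) = (behead (descents true w) == E).
  by rewrite descents_rectify.
have := nwords_ballot_descents FE (isT : 0 < d.+2) dn.
have cycE c :
  nwords n.+2 (fun w => (count id w == c) && (behead (descents true w) == E)) =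
  nwords n.+2 (fun w => (count id w == c) && (cyclic_descents w == true :: E)) +
  nwords n.+2 (fun w => (count id w == c) && (cyclic_descents w == false :: E)).
  rewrite -(nwords_cons_split (f := cyclic_descents)) => [|w sw].
    by apply: eq_nwords => -[].
  by rewrite size_descents sw sE.
rewrite !cycE.
pose P w := ballot 0 w && (count id w == d.+2).
have PE F : nwords n.+2 (fun w => [&& ballot 0 w, count id w == d.+2 & F w]) =
  nwords n.+2 (fun w => P w && F w).
  by apply: eq_nwords => w _; rewrite andbA.
rewrite !PE in trueE *.
rewrite (nwords_cons_split (f := ballot_cdes)) => [|w sw]; last first.
  by rewrite /= size_behead size_descents sw sE.
rewrite -trueE /=; lia.
Qed.

Lemma nwords_cyclic_rot n c E : size E = n ->
  nwords n (fun w => (count id w == c) && (cyclic_descents w == E)) =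
  nwords n (fun w => (count id w == c) && (cyclic_descents w == rot 1 E)).
Proof.
move=> sE.
have rotE w : cyclic_descents (rot 1 w) = rot 1 (cyclic_descents w).
  case: w => [|x w] //; rewrite /cyclic_descents !rot1_cons last_rcons /=.
  by rewrite descents_rcons.
apply: (nwords_bij (g := rot 1)) => [w sw /andP[/eqP <- /eqP <-]|u v _ _|w sw].
- by rewrite size_rot rotE eqxx andbT (seq.permP (permEl (perm_rot 1 w))).
- exact: rot_inj.
- case/andP=> /eqP cw /eqP dw; exists (rotr 1 w).
  rewrite size_rotr rotrK; split=> //.
  rewrite (seq.permP (permEl (perm_rotr 1 w))) cw eqxx /=.
  by apply/eqP/(@rot_inj 1); rewrite -rotE rotrK.
Qed.

Lemma nwords_ballot_rot n d E : 1 < d -> 2 * d <= n -> size E = n ->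
  nwords n (fun w => [&& ballot 0 w, count id w == d & ballot_cdes w == E]) =
  nwords n (fun w => [&& ballot 0 w, count id w == d & ballot_cdes w == rot 1 E]).
Proof.
move=> d2 dn sE; have e1 := nwords_ballot_cdes d2 dn sE.
have sE' : size (rot 1 E) = n by rewrite size_rot.
have := nwords_ballot_cdes d2 dn sE'.
rewrite -!nwords_cyclic_rot // -e1; lia.
Qed.

(** Rectification distributes the words among the straight shapes with [d] downs,
    where [d] satisfies [k - m <= d <= k] and [d <= n - k]; these bounds imply
    [2 <= d <= n / 2]. *)
Lemma nwords_skew_rot n m k E : m + 2 <= k -> size E = n ->
  nwords n (fun w => [&& ballot m w, count id w == k
                      & ballot_cdes (rectify 0 w) == E]) =
  nwords n (fun w => [&& ballot m w, count id w == k
                      & ballot_cdes (rectify 0 w) == rot 1 E]).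
Proof.
move=> mk sE; rewrite !(nwords_rectify (fun w => ballot_cdes w == _)).
rewrite nwords_by_count [RHS]nwords_by_count; apply: eq_bigr => d _.
have [ok|bad] := boolP ((d <= k <= m + d) && (k + d <= n)).
  have d2 : 1 < d by lia.
  have dn : 2 * d <= n by lia.
  have := nwords_ballot_rot d2 dn sE.
  have E' F : nwords n (fun w => [&& ballot 0 w, count id w == d & F w]) =
    nwords n (fun w => [&& ballot 0 w, count id w <= k <= m + count id w,
                         k + count id w <= n & F w] && (count id w == d)).
    apply: eq_nwords => w _; case: (ballot 0 w) => //=.
    have [->|_] := eqVneq (count id w) d; rewrite ?andbT ?andbF //=.
    by move/andP: ok => [-> ->].
  by rewrite !E'.
apply: eq_nwords => w _ /=; have [->|_] := eqVneq (count id w) d;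
  rewrite ?andbF // !andbT.
by case/nandP: bad => /negbTE ->; rewrite ?andbF.
Qed.

(** * Jeu de taquin slides in two rows *)

(** A slide on the part of the tableau weakly right of the hole, when the hole is
    in row 1: [a] is row 1 after the hole, [bs] is row 2 from the column of the
    hole on.  Once the hole moves down, it only shifts row 2 to the left. *)
Fixpoint slide_rows (a bs : seq nat) : seq nat * seq nat :=
  match a, bs with
  | _, [::] => (a, [::])
  | [::], x :: b => ([:: x], b)
  | y :: a', x :: b =>
      if y < x then (y :: (slide_rows a' b).1, x :: (slide_rows a' b).2)
      else (x :: a, b)
  end.

Lemma positions_disjoint s w x : x \in positions s false w -> x \notin positions s true w.
Proof.
rewrite !mem_positions => /andP[lt /eqP e]; rewrite lt /=.
by rewrite (set_nth_default true) ?e //; lia.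
Qed.

(** The first [h] downs cannot take the path below 0. *)
Lemma take_positions_rectify s h w :
  take h (positions s true (rectify h w)) = take h (positions s true w).
Proof.
elim: w s h => [|[] w IH] s [|h] //=; rewrite ?take0 //.
  by rewrite IH.
have := IH s.+1 h.+2 => /(congr1 (take h.+1)).
by rewrite !take_takel.
Qed.

(** At height [h] the hole has a column such that the next entry of row 2 below
    it is the [h]-th down (from 0) still to come.  The hole passes the ups in row 1
    until this down is the very next letter, which happens at height 0; that is
    the down flipped by [rectify h], and there is only one as the path is
    ballot from [h + 1]. *)
Lemma slide_rows_positions s h w : ballot h.+1 w ->
  slide_rows (positions s false w) (drop h (positions s true w)) =
  (positions s false (rectify h w), drop h (positions s true (rectify h w))).
Proof.
have nilE a : slide_rows a [::] = (a, [::]) by case: a.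
elim: w s h => [|[] w IH] s h //=.
- case: h => [|h] /= b; last by rewrite IH.
  rewrite drop0 (rectify_id b).
  case e : (positions s.+1 false w) => [|y a] //=; rewrite ?e ?drop0 //.
  have : y \in positions s.+1 false w by rewrite e inE eqxx.
  by rewrite mem_positions => /andP[/andP[lt _] _]; rewrite ltnNge ltnW.
- move=> b; have := IH s.+1 h.+1 b; have := take_positions_rectify s.+1 h.+1 w.
  set X' := positions _ true (rectify _ _); set X := positions _ true w => eX.
  case: (ltnP h (size X)) => [lt|le].
    rewrite (drop_nth 0 lt) => -> /=.
    have /andP[-> _] := nth_positions_bounds lt.
    congr pair; rewrite -[X' in RHS](cat_take_drop h.+1) eX.
    by rewrite (take_nth 0 lt) cat_rcons drop_size_cat // size_takel // ltnW.
  have eXX : X' = X.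
    have le' : size X' <= h.
      by rewrite (leq_trans _ le) // !size_positions_true count_rectify_leq.
    by rewrite -[X'](take_oversize (leqW le')) eX take_oversize // ltnW.
  rewrite eXX !drop_oversize ?nilE //; last lia.
  by case=> <-.
Qed.

Section TwoRows.
Variables (c n : nat).

(** Boxes beyond the ends of the rows get the default value 0, which marks them
    as outside the shape. *)
Definition fill (r : 'I_2 -> seq nat) : tableau 2 c n :=
  [ffun p : 'I_2 * 'I_c => inord (nth 0 (r p.1) p.2)].

Definition rows (r1 r2 : seq nat) (i : 'I_2) : seq nat :=
  if i == ord0 then r1 else r2.

Lemma fillE r (p : 'I_2 * 'I_c) : nth 0 (r p.1) p.2 <= n -> fill r p = nth 0 (r p.1) p.2 :> nat.
Proof. by move=> le; rewrite ffunE inordK. Qed.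

Lemma eq_fill r r' : (forall i j, nth 0 (r i) j = nth 0 (r' i) j) -> fill r = fill r'.
Proof. by move=> e; apply/ffunP => p; rewrite !ffunE e. Qed.

Lemma swap_fill r r' (p q : 'I_2 * 'I_c) :
    nth 0 (r' p.1) p.2 = nth 0 (r q.1) q.2 ->
    nth 0 (r' q.1) q.2 = nth 0 (r p.1) p.2 ->
    (forall x, x != p -> x != q -> nth 0 (r' x.1) x.2 = nth 0 (r x.1) x.2) ->
  swap_boxes (fill r) p q = fill r'.
Proof.
move=> ep eq ex; apply/ffunP => x; rewrite !ffunE; congr inord.
by case: tpermP => [->|->|/eqP np /eqP nq] //; rewrite ex.
Qed.

Lemma jdt_next_some (T : tableau 2 c n) p q :
    right_or_below p q -> 0 < T q ->
    (forall q', right_or_below p q' -> 0 < T q' -> q' = q \/ T q < T q') ->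
  jdt_next T p = Some q.
Proof.
move=> pq Tq Hq; rewrite /jdt_next; case: pickP => [q'|/(_ q)].
  case/and3P=> pq' Tq' /forallP/(_ q); rewrite pq Tq /= => le.
  by case: (Hq q' pq' Tq') => [->//|]; lia.
rewrite pq Tq /= => /negbT/forallPn[q']; rewrite negb_imply -ltnNge.
by case/andP=> /andP[pq' Tq'] lt; case: (Hq q' pq' Tq') => [e|]; [subst q'|]; lia.
Qed.

Lemma jdt_next_none (T : tableau 2 c n) p :
  (forall q, right_or_below p q -> T q = 0 :> nat) -> jdt_next T p = None.
Proof.
move=> H; rewrite /jdt_next; case: pickP => // q /and3P[pq].
by rewrite H.
Qed.

Lemma nth_swap (pre s : seq nat) x j :
  nth 0 (pre ++ x :: 0 :: s) j =
  if j == size pre then x else if j == (size pre).+1 then 0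
  else nth 0 (pre ++ 0 :: x :: s) j.
Proof.
rewrite !nth_cat; case: ltngtP => [lt|gt|->]; last by rewrite subnn.
  by case: eqP => //; lia.
case: eqP => [->|ne]; first by rewrite subSnn.
by case e : (j - size pre) => [|[|i]] //; lia.
Qed.

(** With nothing below the rest of its row, the hole goes to the end of the row.
    This covers both row 2 and the part of row 1 beyond the end of row 2. *)
Lemma slide_right fuel r (p : 'I_2 * 'I_c) pre b :
    r p.1 = pre ++ 0 :: b -> p.2 = size pre :> nat -> size (r p.1) <= c ->
    all (fun x => 0 < x <= n) b ->
    (forall i : 'I_2, i = p.1.+1 :> nat -> size (r i) <= size pre) ->
    c - size pre <= fuel ->
  slide_loop fuel (fill r) p = fill (fun i => if i == p.1 then pre ++ b else r i).
Proof.
elim: b fuel r p pre => [|x b IH] fuel r [i j] pre /= ri jE sz ab below lef;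
  (case: fuel lef => [|fuel] lef /=; first by move: sz; rewrite ri size_cat /=; lia).
  rewrite jdt_next_none; last first.
    move=> [i' j']; rewrite /right_or_below /= => /orP[] /andP[/eqP ei /eqP ej].
      move: ei => /val_inj ei; subst i'.
      rewrite fillE /= ri nth_default ?size_cat //=; lia.
    by rewrite fillE /= nth_default // (leq_trans (below _ _)) //; lia.
  apply: eq_fill => i' j'; case: eqP => // ->.
  rewrite ri cats0 nth_cat; case: ltnP => // le; rewrite [RHS](nth_default _ le).
  by case: (j' - _) => //= ?; rewrite nth_nil.
case/andP: ab => x_n ab.
have lt : j.+1 < c by move: sz; rewrite ri size_cat /=; lia.
pose q : 'I_2 * 'I_c := (i, Ordinal lt).
have Eq : nth 0 (r i) j.+1 = x.
  rewrite ri jE nth_cat ltnNge leqnSn subSnn //.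
rewrite (@jdt_next_some _ _ q); first last.
- move=> [i' j']; rewrite /right_or_below /= => /orP[] /andP[/eqP ei /eqP ej].
    by move=> _; left; rewrite /q; congr pair; apply: val_inj.
  by rewrite fillE /= nth_default // (leq_trans (below _ _)) //; lia.
- by rewrite fillE /= Eq; case/andP: x_n.
- by rewrite /right_or_below /= !eqxx.
rewrite (@swap_fill _ (fun i' => if i' == i then rcons pre x ++ 0 :: b else r i'));
  first last.
- move=> [i' j'] np nq /=; case: eqP => // ei; subst i'.
  rewrite cat_rcons ri nth_swap.
  case: eqP => [e|_]; first by case/eqP: np; congr pair; apply: val_inj; rewrite /= e.
  case: eqP => [e|_] //; case/eqP: nq; congr pair; apply: val_inj => /=; lia.
- rewrite /= eqxx cat_rcons nth_swap jE eqxx ifF; last by apply/eqP; lia.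
  by rewrite ri nth_cat ltnn subnn.
- by rewrite /= eqxx cat_rcons nth_swap Eq jE eqxx.
rewrite (IH _ _ q (rcons pre x)) /= ?eqxx //.
- by apply: eq_fill => i' j'; case: eqP => // _; rewrite cat_rcons.
- by rewrite size_rcons jE.
- by move: sz; rewrite ri cat_rcons !size_cat.
- move=> i' ei; case: eqP => [e|_]; first by move: ei; rewrite e; lia.
  by rewrite size_rcons (leq_trans (below _ _)).
- rewrite size_rcons; lia.
Qed.

Lemma slide_down fuel (p : 'I_2 * 'I_c) pre pre2 a x b :
    p.1 = ord0 -> p.2 = size pre :> nat -> size pre2 = size pre ->
    size (pre ++ 0 :: a) <= c -> size (pre2 ++ x :: b) <= c ->
    all (fun x => 0 < x <= n) (a ++ x :: b) ->
    (forall y, y = head 0 a -> 0 < y -> x < y) ->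
    c - size pre < fuel ->
  slide_loop fuel (fill (rows (pre ++ 0 :: a) (pre2 ++ x :: b))) p =
  fill (rows (pre ++ x :: a) (pre2 ++ b)).
Proof.
case: fuel p => [|fuel] [i j] //= -> jE e2 sza szb.
rewrite all_cat /= => /and3P[aa x_n ab] hd lef.
pose q : 'I_2 * 'I_c := (ord_max, j).
have Eq : nth 0 (pre2 ++ x :: b) j = x by rewrite nth_cat jE e2 ltnn subnn.
rewrite (@jdt_next_some _ _ q); first last.
- move=> [i' j']; rewrite /right_or_below /= => /orP[] /andP[/eqP ei /eqP ej].
    have -> : i' = ord0 by apply: val_inj.
    have E : nth 0 (pre ++ 0 :: a) j' = head 0 a.
      by rewrite nth_cat ej jE ltnNge leqnSn subSnn /= nth0.
    have le : head 0 a <= n by case: (a) aa => //= ? ? /andP[/andP[]].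
    rewrite !fillE /rows /= ?E ?Eq //; last by case/andP: x_n.
    by move=> y0; right; apply: hd.
  by move=> _; left; rewrite /q; congr pair; apply: val_inj; rewrite //= ei.
- by rewrite fillE /rows /= Eq; case/andP: x_n.
- by rewrite /right_or_below /= eqxx.
rewrite (@swap_fill _ (rows (pre ++ x :: a) (pre2 ++ 0 :: b))); first last.
- move=> [i' j'] /eqP np /eqP nq /=; rewrite /rows; case: eqP => [ei|/eqP ni].
    rewrite !nth_cat; case: ltnP => // le; case e : (j' - size pre) => //.
    by case: np; rewrite ei; congr pair; apply: val_inj => /=; lia.
  rewrite !nth_cat; case: ltnP => // le; case e : (j' - size pre2) => //.
  case: nq; congr pair; apply: val_inj => /=; last by lia.
  by case: i' ni {np} => -[|[|i']].
- by rewrite /rows /= !nth_cat jE e2 !ltnn !subnn.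
- by rewrite /rows /= Eq nth_cat jE ltnn subnn.
rewrite (slide_right (pre := pre2) (b := b)) //=.
- by apply: eq_fill => -[[|[|i']] lt] j'; rewrite /rows.
- by rewrite jE e2.
- by move: szb; rewrite /rows /= !size_cat.
- by case=> i' lt /= e; move: lt; rewrite e.
- lia.
Qed.

(** If row 2 ends before the column of the hole, its kept part [pre2] may be
    shorter than [pre]; otherwise both end just before the hole. *)
Lemma slide_fill fuel (p : 'I_2 * 'I_c) pre pre2 a b :
    p.1 = ord0 -> p.2 = size pre :> nat ->
    size pre2 <= size pre -> (b != [::] -> size pre2 = size pre) ->
    size (pre ++ 0 :: a) <= c -> size (pre2 ++ b) <= c ->
    all (fun x => 0 < x <= n) (a ++ b) -> {in a, forall x, x \notin b} ->
    c - size pre < fuel ->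
  slide_loop fuel (fill (rows (pre ++ 0 :: a) (pre2 ++ b))) p =
  fill (rows (pre ++ (slide_rows a b).1) (pre2 ++ (slide_rows a b).2)).
Proof.
elim: a b fuel p pre pre2 => [|y a IH] [|x b] fuel [i j] pre pre2 /= -> jE le2 eq2
  sza szb ab disj lef.
- rewrite (slide_right (pre := pre) (b := [::])) //=; last lia.
    by apply: eq_fill => i' j'; rewrite /rows; case: eqP.
  by move=> i' /= e; rewrite /rows cats0 -val_eqE /= e.
- by rewrite (slide_down (fuel := fuel)) ?eq2 // => z ->.
- rewrite (slide_right (pre := pre) (b := y :: a)) //=; last lia.
  + by apply: eq_fill => i' j'; rewrite /rows; case: eqP.
  + by move: ab; rewrite cats0.
  + by move=> i' /= e; rewrite /rows cats0 -val_eqE /= e.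
- case: ltnP => [ltyx|lexy]; last first.
    rewrite (slide_down (fuel := fuel)) ?eq2 // => z /= -> _.
    have := disj y; rewrite !inE eqxx => /(_ isT) /norP[]; lia.
  case: fuel lef => // fuel lef /=.
  case/andP: ab => y_n; rewrite all_cat /= => /and3P[aa x_n ab].
  have lt : j.+1 < c by move: sza; rewrite size_cat /=; lia.
  pose q : 'I_2 * 'I_c := (ord0, Ordinal lt).
  have Eq : nth 0 (pre ++ [:: 0, y & a]) j.+1 = y.
    by rewrite nth_cat jE ltnNge leqnSn subSnn.
  have E2 : nth 0 (pre2 ++ x :: b) j = x by rewrite nth_cat jE eq2 // ltnn subnn.
  rewrite (@jdt_next_some _ _ q); first last.
  + move=> [i' j']; rewrite /right_or_below /= => /orP[] /andP[/eqP ei /eqP ej].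
      by move=> _; left; rewrite /q; congr pair; apply: val_inj.
    move=> _; right; have -> : i' = ord_max by apply: val_inj.
    by rewrite !fillE /rows /= ?Eq ?ej ?E2 //; [case/andP: x_n | case/andP: y_n].
  + by rewrite fillE /rows /= Eq; case/andP: y_n.
  + by rewrite /right_or_below /= !eqxx.
  rewrite (@swap_fill _ (rows (rcons pre y ++ 0 :: a) (rcons pre2 x ++ b)));
    first last.
  + move=> [i' j'] /eqP np /eqP nq /=; rewrite !cat_rcons /rows.
    case: eqP => // ei; rewrite nth_swap.
    case: eqP => [e|_]; first by case: np; rewrite ei; congr pair; apply: val_inj; rewrite /= e.
    case: eqP => [e|_] //; case: nq; rewrite ei; congr pair; apply: val_inj => /=.
    lia.
  + rewrite /rows /= cat_rcons nth_swap jE eqxx ifF; last by apply/eqP; lia.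
    by rewrite nth_cat ltnn subnn.
  + by rewrite /rows /= cat_rcons nth_swap Eq jE eqxx.
  rewrite (IH b fuel q) //= ?size_rcons ?jE //.
  + by rewrite !cat_rcons.
  + by rewrite eq2.
  + by move: sza; rewrite cat_rcons !size_cat.
  + by rewrite cat_rcons.
  + by rewrite all_cat aa.
  + move=> z za; have := disj z; rewrite !inE za orbT => /(_ isT).
    by case/norP.
  + lia.
Qed.

(** * The tableau of a word *)

(** When [ballot h w], this is the standard tableau of inner shape (h) with word [w]. *)
Definition word_tab h w : tableau 2 c n :=
  fill (rows (nseq h 0 ++ positions 1 false w) (positions 1 true w)).

Definition fits h w :=
  [/\ size w = n, h + (n - count id w) <= c & count id w <= c].

(** The fuel [2 + c] exceeds the number of columns, which bounds the moves. *)
Lemma slide_word_tab h w (p : 'I_2 * 'I_c) : p.1 = ord0 -> p.2 = h :> nat ->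
  ballot h.+1 w -> fits h.+1 w -> slide (word_tab h.+1 w) p = word_tab h (rectify h w).
Proof.
move=> p1 p2 b [sw szf szt].
have E : slide_rows (positions 1 false w) (drop h (positions 1 true w)) =
  (positions 1 false (rectify h w), drop h (positions 1 true (rectify h w))).
  exact: slide_rows_positions.
rewrite /slide /word_tab -[h.+1]addn1 nseqD -catA -[nseq 1 0 ++ _]/(0 :: _).
rewrite -{1}[positions 1 true w](cat_take_drop h).
rewrite slide_fill ?size_nseq //.
- by rewrite E /= -(take_positions_rectify 1 h w) cat_take_drop.
- by rewrite size_take; case: ifP => //; lia.
- move=> ne; rewrite size_takel // ltnW // ltnNge; apply: contra ne => le.
  by rewrite drop_oversize.
- by rewrite size_cat /= size_nseq size_positions_false sw; lia.
- by rewrite cat_take_drop size_positions_true.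
- rewrite all_cat; apply/andP; split; apply/allP => x; last move/mem_drop;
    by rewrite mem_positions sw => /andP[]; lia.
- by move=> x /positions_disjoint; apply: contra => /mem_drop.
- lia.
Qed.

(** Slides go into columns [m], ..., 1; before the slide into column [j] the
    tableau is that of [rectify j w]. *)
Lemma jdt_word_tab m w : ballot m w -> fits m w ->
  jdt [:: m] (word_tab m w) = word_tab 0 (rectify 0 w).
Proof.
move=> b [sw szf szt].
have slides j (qs : seq ('I_2 * 'I_c)) : j <= m ->
    [seq (nat_of_ord q.1, nat_of_ord q.2) | q : 'I_2 * 'I_c <- qs] = [seq (0, i) | i <- rev (iota 0 j)] ->
  foldl (@slide 2 c n) (word_tab j (rectify j w)) qs = word_tab 0 (rectify 0 w).
  elim: j qs => [|j IH] qs lej; first by case: qs.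
  rewrite -[in iota 0 _]addn1 iotaD rev_cat /=; case: qs => //= q qs [q1 q2 eqs].
  rewrite slide_word_tab ?ballot_rectify //; first by rewrite rectify_rectify // IH //; lia.
    by apply: val_inj.
  have := ballot_rectifyE j.+1 (m - j.+1) w.
  rewrite subnKC // b => /esym le.
  by have := count_rectify_leq j.+1 w; split; rewrite ?size_rectify //; lia.
rewrite /jdt -{1}[w](rectify_id b); apply: slides => //.
rewrite !map_rev; congr rev.
have -> : enum [pred p : 'I_2 * 'I_c | p.2 < nth 0 [:: m] p.1] =
  [seq (ord0, x) | x <- [seq x : 'I_c <- enum 'I_c | x < m]].
  have -> : enum [pred p : 'I_2 * 'I_c | p.2 < nth 0 [:: m] p.1] =
      [seq p : 'I_2 * 'I_c <- prod_enum 'I_2 'I_c | p.2 < nth 0 [:: m] p.1].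
    by rewrite {1}/enum_mem Finite.enum.unlock.
  rewrite /prod_enum enum_ordSl enum_ordSl (size0nil (size_enum_ord 0)) /=.
  rewrite cats0 filter_cat filter_map -[RHS]cats0; congr (_ ++ _).
  apply/eqP; rewrite -[_ == _]negbK -has_filter; apply/hasPn => _ /mapP[x _ ->].
  by rewrite -leqNgt.
rewrite -map_comp -[iota 0 m](@filter_iota_ltn 0 c m); last lia.
by rewrite -val_enum_ord filter_map -map_comp.
Qed.

(** The ordinal [i] stands for [i + 1], whose bit is at position [i + 1] mod [n]. *)
Definition bits_set n (E : bitseq) : {set 'I_n} :=
  [set i : 'I_n | nth false E (ordS i)].

Lemma word_tabE h w p : fits h w -> word_tab h w p =
  nth 0 (rows (nseq h 0 ++ positions 1 false w) (positions 1 true w) p.1) p.2 :> nat.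
Proof.
case=> sw _ _; rewrite /word_tab fillE //.
set s := rows _ _ _; case: (ltnP p.2 (size s)) => [lt|le]; last by rewrite nth_default.
have := mem_nth 0 lt; rewrite /s /rows; case: ifP => _.
  rewrite mem_cat mem_nseq mem_positions sw => /orP[/andP[_ /eqP ->]//|/andP[bd _]].
  by move: bd; set x := nth _ _ _; lia.
by rewrite mem_positions sw => /andP[bd _]; move: bd; set x := nth _ _ _; lia.
Qed.

Lemma word_tab_mem h w (i : 'I_2) v : fits h w -> 0 < v ->
  reflect (exists j, word_tab h w (i, j) = v :> nat) (v \in positions 1 (i != ord0) w).
Proof.
move=> ft v0; have [sw szf szt] := ft.
apply: (iffP idP) => [vin|[j]].
  have lt : index v (rows (nseq h 0 ++ positions 1 false w) (positions 1 true w) i) < c.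
    move: vin; rewrite /rows; case: (i == ord0) => /= vin.
      have vin' : v \in nseq h 0 ++ positions 1 false w by rewrite mem_cat vin orbT.
      by rewrite (leq_trans _ szf) // -sw -(size_positions_false 1) -{2}(size_nseq h 0)
        -size_cat index_mem.
    by rewrite (leq_trans _ szt) // -(size_positions_true 1) index_mem.
  exists (Ordinal lt); rewrite word_tabE //= nth_index // /rows.
  by move: vin; case: (i == ord0); rewrite //= mem_cat => ->; rewrite orbT.
rewrite word_tabE //= /rows => e.
have vin : v \in (if i == ord0 then nseq h 0 ++ positions 1 false w else positions 1 true w).
  rewrite -e mem_nth // ltnNge; apply/negP => le.
  by move: v0; rewrite -e nth_default.
move: vin; case: (i == ord0); rewrite //= mem_cat mem_nseq; by rewrite gtn_eqF // andbF.
Qed.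

Lemma Des_word_tab h w : fits h w -> Des (word_tab h w) = bits_set n (descents true w).
Proof.
move=> ft; have [sw _ _] := ft; apply/setP => i; rewrite !inE /=.
have -> : nth false (descents true w) (i.+1 %% n) =
    (i.+1 < n) && (~~ nth true w i && nth false w i.+1).
  case: ltnP => [lt|le]; first by rewrite modn_small // nth_descents.
  have -> : i.+1 = n by have := ltn_ord i; lia.
  by rewrite modnn; case: (w).
apply/existsP/idP => [[p /existsP[q /and3P[/eqP ep /eqP eq lt]]]|].
  have [ep1 eq1] : p.1 = ord0 /\ q.1 = ord_max.
    by move: lt; case: (p.1) (q.1) => -[|[|?]] ? [[|[|?]] ?] // _; split; apply: val_inj.
  have : i.+1 \in positions 1 (p.1 != ord0) w.
    by apply/(word_tab_mem _ ft) => //; exists p.2; rewrite -surjective_pairing.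
  have : i.+2 \in positions 1 (q.1 != ord0) w.
    by apply/(word_tab_mem _ ft) => //; exists q.2; rewrite -surjective_pairing.
  rewrite ep1 eq1 /= !mem_positions1 //= => /eqP -> /eqP ->; rewrite andbT.
  have := leq_ord (word_tab h w q); rewrite eq; lia.
case/and3P=> lt w0 w1.
have /(word_tab_mem _ ft) [//|j ej] : i.+1 \in positions 1 ((ord0 : 'I_2) != ord0) w.
  by rewrite mem_positions1 //= eqbF_neg.
have /(word_tab_mem _ ft) [//|j' ej'] : i.+2 \in positions 1 ((ord_max : 'I_2) != ord0) w.
  by rewrite mem_positions1 //= eqb_id.
by exists (ord0, j); apply/existsP; exists (ord_max, j'); rewrite ej ej' !eqxx.
Qed.

Lemma entry_ord (T : tableau 2 c n) (p : 'I_2 * 'I_c) : entry T p.1.+1 p.2.+1 = T p.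
Proof.
rewrite /entry; case: pickP => [q /andP[/eqP [/val_inj e1] /eqP[/val_inj e2]]|/(_ p)].
  by rewrite (surjective_pairing q) e1 e2 -surjective_pairing.
by rewrite !eqxx.
Qed.

Lemma entry_out (T : tableau 2 c n) i j : c < j -> entry T i j = 0.
Proof.
move=> lt; rewrite /entry; case: pickP => // q /andP[_ /eqP e].
by move: lt; rewrite -e ltnNge ltn_ord.
Qed.

(** Beyond the box both sides are 0, because the rows fit in it. *)
Lemma entry_word_tab h w (i : 'I_2) j : fits h w -> entry (word_tab h w) i.+1 j.+1 =
  nth 0 (rows (nseq h 0 ++ positions 1 false w) (positions 1 true w) i) j.
Proof.
move=> ft; case: (ltnP j c) => [lt|le].
  by rewrite -(word_tabE (i, Ordinal lt) ft) -entry_ord.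
rewrite entry_out // nth_default // (leq_trans _ le) //.
have [sw szf szt] := ft; rewrite /rows; case: ifP => _.
  by rewrite size_cat size_nseq size_positions_false sw.
by rewrite size_positions_true.
Qed.

Lemma row_size_word_tab h w : fits h w -> row_size (word_tab h w) 2 = count id w.
Proof.
move=> ft; have [sw _ szt] := ft; rewrite /row_size.
have -> : [set p : 'I_2 * 'I_c | (p.1.+1 == 2) && (0 < word_tab h w p)] =
    [set (ord_max : 'I_2, j) | j in [set j : 'I_c | j < count id w]].
  apply/setP => -[i j]; rewrite !inE; apply/andP/imsetP => [[/eqP [e]]|[j']].
    have -> : i = ord_max by apply: val_inj.
    rewrite word_tabE //= /rows /= => gt; exists j => //; rewrite inE ltnNge.
    by apply/negP => le; rewrite nth_default ?size_positions_true in gt.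
  rewrite inE => lt [-> ->]; split=> //; rewrite word_tabE //= /rows /=.
  rewrite -(size_positions_true 1) in lt.
  by have /andP[] := nth_positions_bounds lt.
rewrite card_imset => [|j j' [] //].
have -> : [set j : 'I_c | j < count id w] = [set widen_ord szt i | i : 'I_(count id w)].
  apply/setP => j; rewrite inE; apply/idP/imsetP => [lt|[i _ ->]] /=; last exact: ltn_ord.
  by exists (Ordinal lt) => //; apply: val_inj.
rewrite card_imset ?card_ord // => i j /(congr1 val) /= e; exact: val_inj.
Qed.

Lemma n_is_cdes_word_tab w : fits 0 w -> 1 < count id w ->
  n_is_cdes (word_tab 0 w) = word_n_is_cdes w.
Proof.
move=> ft; rewrite /n_is_cdes /word_n_is_cdes row_size_word_tab //.
case: (count id w) => [|[|d]] // _ /=.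
have e1 j : entry (word_tab 0 w) 1 j.+1 = nth 0 (positions 1 false w) j.
  exact: (entry_word_tab ord0 j ft).
have e2 j : entry (word_tab 0 w) 2 j.+1 = nth 0 (positions 1 true w) j.
  exact: (entry_word_tab ord_max j ft).
rewrite !e2; congr (_ && _); apply: eq_in_all => i; rewrite mem_index_iota.
by case: i => [|[|i]] //= _; rewrite e1 e2.
Qed.

Lemma cDes_word_tab w : fits 0 w -> 1 < count id w ->
  cDes (word_tab 0 w) = bits_set n (ballot_cdes w).
Proof.
move=> ft d2; rewrite /cDes n_is_cdes_word_tab // Des_word_tab //.
apply/setP => i; rewrite !inE /=.
have [lt|le] := ltnP i.+1 n.
  by rewrite modn_small // ltn_eqF //= orbF; case: (descents true w) => [|? ?] //=;
  rewrite nth_nil.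
have -> : i.+1 = n by have := ltn_ord i; lia.
by rewrite modnn eqxx /= ; case: (w).
Qed.
End TwoRows.

Section Bijection.
Variables (m k n : nat).
Hypotheses (hkn : k <= n) (hmk : m <= k) (hk : 2 * k <= n + m).
Let c := n - k + m.
Local Notation word_tab := (@word_tab c n).

Lemma fits_of_count w : size w = n -> count id w = k -> fits c n m w.
Proof. by move=> sw cw; split=> //; rewrite cw /c; lia. Qed.

Lemma in_skewE p : @in_skew [:: c; k] [:: m] 2 c p =
  (if p.1 == ord0 then m <= p.2 else p.2 < k).
Proof.
case: p => -[[|[|i]] lti] [j ltj]; rewrite /in_skew //=.
by rewrite ltj andbT.
Qed.

Lemma is_syt_word_tab w : size w = n -> count id w = k -> ballot m w ->
  @is_syt [:: c; k] [:: m] n (word_tab m w).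
Proof.
move=> sw cw b; have ft := fits_of_count sw cw.
have szA : size (positions 1 false w) = n - k by rewrite size_positions_false sw cw.
have szB : size (positions 1 true w) = k by rewrite size_positions_true.
have rowA (j : 'I_c) : m <= j -> word_tab m w (ord0, j) = nth 0 (positions 1 false w) (j - m) :> nat.
  by move=> le; rewrite word_tabE // /rows /= nth_cat size_nseq ltnNge le.
have rowB (j : 'I_c) : word_tab m w (ord_max, j) = nth 0 (positions 1 true w) j :> nat.
  by rewrite word_tabE.
have gtA (j : 'I_c) : m <= j -> j - m < n - k by have := ltn_ord j; rewrite /c; lia.
have i2 (i : 'I_2) : i != ord0 -> i = ord_max.
  by case: i => -[|[|i]] // lt _; apply: val_inj.
have uniqP b0 : uniq (positions 1 b0 w) by apply: sorted_uniq (positions_sorted _ _ _); [exact: ltn_trans | exact: ltnn].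
have supp i j : (0 < word_tab m w (i, j)) = @in_skew [:: c; k] [:: m] 2 c (i, j).
  rewrite in_skewE /=; case: eqP => [->|/eqP/i2 ->].
    case: (leqP m j) => [le|lt].
      rewrite rowA // ; have := gtA j le; rewrite -szA => /nth_positions_bounds /andP[] //.
    by rewrite word_tabE // /rows /= nth_cat size_nseq lt nth_nseq lt.
  rewrite rowB; case: (ltnP j k) => [lt|le]; last by rewrite nth_default ?szB.
  by rewrite -szB in lt; have /andP[] := nth_positions_bounds lt.
apply/and4P; split.
- by apply/forallP => -[i j]; rewrite supp.
- apply/forallP => v; apply/implyP => v0.
  pose i : 'I_2 := if nth true w v.-1 then ord_max else ord0.
  have vn : v.-1 < size w by rewrite sw; have := ltn_ord v; lia.
  have /(word_tab_mem _ ft) [//|j ej] : (v : nat) \in positions 1 (i != ord0) w.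
    rewrite mem_positions1 // /i (set_nth_default true) //.
    by case: (nth true w _).
  apply/cards1P; exists (i, j); apply/setP => -[i' j']; rewrite !inE.
  apply/eqP/eqP => [e|[-> ->]]; last exact: val_inj.
  have : (v : nat) \in positions 1 (i' != ord0) w by apply/(word_tab_mem _ ft) => //; exists j'; rewrite e.
  rewrite mem_positions1 // (set_nth_default true) // => /eqP ei.
  have ii : i' = i.
    by rewrite /i ei; case: eqP => [->//|/eqP/i2].
  move/(congr1 val): e => /=; rewrite ii => e.
  have := supp i j; have := supp i j'; rewrite e ej v0 !in_skewE /=.
  move=> /esym s2 /esym s1; congr pair; apply: val_inj; apply/eqP => /=.
  rewrite -ej in e; move: e s1 s2.
  case: eqP => [->|/eqP/i2 ->] e s1 s2.
    move: e; rewrite !rowA // => /eqP; rewrite nth_uniq ?szA ?gtA //; lia.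
  by move: e; rewrite !rowB => /eqP; rewrite nth_uniq ?szB.
- apply/forallP => -[i j]; apply/forallP => -[i' j']; rewrite !in_skewE /=.
  apply/implyP => /and4P[s1 s2 /eqP ei lt]; subst i'; move: s1 s2.
  case: eqP => [->|/eqP/i2 ->] s1 s2.
    rewrite !rowA // (sorted_ltn_nth ltn_trans) ?positions_sorted ?inE ?szA ?gtA //.
    lia.
  by rewrite !rowB (sorted_ltn_nth ltn_trans) ?positions_sorted ?inE ?szB.
- apply/forallP => -[i j]; apply/forallP => -[i' j']; rewrite !in_skewE /=.
  apply/implyP => /and4P[s1 s2 /eqP ej lt]; subst j'; move: s1 s2.
  have [-> ->] : i = ord0 /\ i' = ord_max.
    by move: lt; case: (i) (i') => -[|[|?]] ? [[|[|?]] ?] // _; split; apply: val_inj.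
  move=> /= s1 s2; rewrite rowA // rowB.
  have [|_] := elimT (ballotP m 1 w) b (j - m); first by rewrite subnKC // cw.
  by rewrite subnKC.
Qed.

Definition word_of (T : tableau 2 c n) : n.-tuple bool :=
  [tuple [exists p, (T p == i.+1 :> nat) && (p.1 != ord0)] | i < n].

Lemma nth_word_of d T v : v < n ->
  nth d (word_of T) v = [exists p, (T p == v.+1 :> nat) && (p.1 != ord0)].
Proof. by move=> lt; rewrite (nth_map (Ordinal lt)) ?size_enum_ord // nth_enum_ord. Qed.

Lemma word_of_word_tab w : size w = n -> count id w = k -> word_of (word_tab m w) = w :> bitseq.
Proof.
move=> sw cw; have ft := fits_of_count sw cw.
apply: (@eq_from_nth _ false); rewrite size_tuple // => v lt.
rewrite nth_word_of //; apply/existsP/idP => [[[i j] /= /andP[/eqP e ni]]|wv].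
  have : v.+1 \in positions 1 (i != ord0) w by apply/(word_tab_mem _ ft) => //; exists j.
  by rewrite ni mem_positions1 //= => /eqP.
have /(word_tab_mem _ ft) [//|j ej] : v.+1 \in positions 1 ((ord_max : 'I_2) != ord0) w.
  by rewrite mem_positions1 //= eqb_id.
by exists (ord_max, j); rewrite ej eqxx.
Qed.

(** Each row of a standard tableau is increasing, hence determined by the set of
    its entries; the column condition is [ballotP]. *)
Lemma word_of_sytP T : @is_syt [:: c; k] [:: m] n T ->
  [/\ count id (word_of T) = k, ballot m (word_of T) & T = word_tab m (word_of T)].
Proof.
case/and4P=> /forallP supp /forallP once /forallP rowT /forallP colT.
have i2 (i : 'I_2) : i != ord0 -> i = ord_max.
  by case: i => -[|[|i]] // lt _; apply: val_inj.
set w := word_of T; have sw : size w = n by rewrite size_tuple.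
have unT p q : 0 < T p -> T p = T q -> p = q.
  move=> p0 e; have /implyP/(_ p0)/cards1P[x ex] := once (T p).
  have : p \in [set x] by rewrite -ex inE.
  have : q \in [set x] by rewrite -ex inE e.
  by rewrite !inE => /eqP -> /eqP ->.
have memw v b : reflect (exists p, [/\ T p = v :> nat, 0 < v & (p.1 != ord0) = b])
    (v \in positions 1 b w).
  rewrite mem_positions sw; apply: (iffP andP) => [[bd /eqP nw]|[p [ep v0 ip]]].
    have vn : v < n.+1 by lia.
    have /implyP := once (Ordinal vn); rewrite (_ : 0 < Ordinal vn); last by rewrite /=; lia.
    move=> /(_ isT)/cards1P[p ex].
    have : p \in [set p] by rewrite inE.
    rewrite -ex inE => /eqP ep; exists p; split; [by rewrite ep | lia |].
    rewrite -nw nth_word_of; last lia.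
    apply/idP/existsP => [ip|[q /andP[/eqP eq iq]]].
      by exists p; rewrite ip andbT ep /=; apply/eqP; lia.
    rewrite (unT p q) //; first by rewrite ep /=; lia.
    by apply: val_inj; rewrite /= eq ep /=; lia.
  have vn : v <= n by rewrite -ep -ltnS.
  split; first lia.
  rewrite nth_word_of; last lia.
  apply/eqP; rewrite -ip; apply/existsP/idP => [[q /andP[/eqP eq iq]]|ip'].
    rewrite (unT p q) //; first by rewrite ep.
    by apply: val_inj; rewrite /= eq ep /=; lia.
  by exists p; rewrite ip' ep andbT; apply/eqP; lia.
have suppE i j : (0 < T (i, j)) = (if i == ord0 then m <= j else j < k).
  by have /eqP -> := supp (i, j); rewrite in_skewE.
pose A := mkseq (fun i => entry T 1 (m + i).+1) (n - k).
pose B := mkseq (fun i => entry T 2 i.+1) k.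
have ltA i : i < n - k -> m + i < c by rewrite /c; lia.
have ltB i : i < k -> i < c by rewrite /c; lia.
have nthA i (lt : i < n - k) : nth 0 A i = T (ord0, Ordinal (ltA i lt)).
  by rewrite nth_mkseq // -entry_ord.
have nthB i (lt : i < k) : nth 0 B i = T (ord_max, Ordinal (ltB i lt)).
  by rewrite nth_mkseq // -entry_ord.
have eA : positions 1 false w = A.
  apply: (irr_sorted_eq ltn_trans ltnn); first exact: positions_sorted.
    apply/(sortedP 0) => i; rewrite size_mkseq => lt.
    rewrite (nthA _ (ltnW lt)) (nthA _ lt).
    have /forallP/(_ (ord0, Ordinal (ltA _ lt))) := rowT (ord0, Ordinal (ltA _ (ltnW lt))).
    by move/implyP; apply; rewrite !in_skewE /= !leq_addr ltn_add2l /=.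
  move=> v; apply/(memw v false)/mapP => [[[i j] [ep v0 /= /negbFE/eqP ip]]|[i]].
    have le : m <= j by move: v0; rewrite -ep suppE ip.
    have jc : (j : nat) < n - k + m := ltn_ord j.
    exists (j - m); first by rewrite mem_iota; lia.
    by rewrite subnKC // -ep -entry_ord ip.
  rewrite mem_iota => lt ->; have lt' : i < n - k by lia.
  rewrite -(nth_mkseq 0 (fun i => entry T 1 (m + i).+1) lt') nthA.
  exists (ord0, Ordinal (ltA _ lt')); split=> //.
  by rewrite suppE /= leq_addr.
have eB : positions 1 true w = B.
  apply: (irr_sorted_eq ltn_trans ltnn); first exact: positions_sorted.
    apply/(sortedP 0) => i; rewrite size_mkseq => lt.
    rewrite (nthB _ (ltnW lt)) (nthB _ lt).
    have /forallP/(_ (ord_max, Ordinal (ltB _ lt))) := rowT (ord_max, Ordinal (ltB _ (ltnW lt))).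
    by move/implyP; apply; rewrite !in_skewE /= ltnS leqnn andbT lt ltnW.
  move=> v; apply/(memw v true)/mapP => [[[i j] [ep v0 /= /i2 ip]]|[i]].
    have lt : j < k by move: v0; rewrite -ep suppE ip.
    by exists (j : nat); [rewrite mem_iota | rewrite -ep -entry_ord ip].
  rewrite mem_iota => lt ->; have lt' : i < k by lia.
  rewrite -(nth_mkseq 0 (fun i => entry T 2 i.+1) lt') nthB.
  exists (ord_max, Ordinal (ltB _ lt')); split=> //.
  by rewrite suppE /=.
have cw : count id w = k by rewrite -(size_positions_true 1) eB size_mkseq.
split=> //.
  apply/(ballotP m 1) => i; rewrite cw eA eB size_mkseq => lt.
  have lt' : i < n - k by lia.
  split=> //; rewrite nthA nthB.
  have /forallP/(_ (ord_max, Ordinal (ltB _ lt))) := colT (ord0, Ordinal (ltA _ lt')).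
  move/implyP; apply; rewrite !in_skewE /= lt leq_addr /=.
  by rewrite -val_eqE /= eqxx.
have ft := fits_of_count sw cw.
apply/ffunP => -[i j]; apply: val_inj; rewrite [RHS]word_tabE // eA eB /rows /=.
case: eqP => [->|/eqP/i2 ->].
  rewrite nth_cat size_nseq nth_nseq if_same; case: ltnP => [lt|le].
    by apply/eqP; rewrite -leqn0 leqNgt suppE /= -ltnNge.
  have lt : j - m < n - k by rewrite ltn_subLR // addnC; exact: ltn_ord.
  by rewrite nthA; congr (val (T (_, _))); apply: val_inj; rewrite /= subnKC.
case: (ltnP j k) => [lt|le].
  by rewrite nthB; congr (val (T (_, _))); apply: val_inj.
rewrite nth_default ?size_mkseq //.
by apply/eqP; rewrite -leqn0 leqNgt suppE /= -leqNgt.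
Qed.
End Bijection.

(** * Sets encoded by bit sequences *)

Lemma bits_set_inj n : {in [pred E | size E == n] &, injective (bits_set n)}.
Proof.
move=> E E' /eqP sE /eqP sE' /setP e; apply: (@eq_from_nth _ false); rewrite sE ?sE' //.
move=> j lt; have := e (ord_pred (Ordinal lt)).
by rewrite !inE ord_predK.
Qed.

(** Adding 1 to the elements modulo [n] moves the bits cyclically one place to
    the right. *)
Lemma shift_bits_set n E : size E = n -> shift (bits_set n E) = bits_set n (rotr 1 E).
Proof.
move=> sE; apply/setP => i.
rewrite -[i in LHS]ord_predK /shift mem_imset ?inE; last exact: can_inj (@ordSK n).
rewrite ord_predK /=; case/lastP: E sE => [|E x] sE.
  by have := ltn_ord i; rewrite -{2}sE.
rewrite rotr1_rcons nth_rcons; move: sE; rewrite size_rcons => sE.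
have [lt|le] := ltnP i.+1 n.
  by rewrite modn_small //= ifT //; lia.
have ei : i = n.-1 :> nat by have := ltn_ord i; lia.
have -> : i.+1 %% n = 0 by rewrite (_ : i.+1 = n) ?modnn //; lia.
by rewrite ei -sE /= ltnn eqxx.
Qed.

Lemma bits_set_surj n (D : {set 'I_n}) : exists2 E, size E = n & bits_set n E = D.
Proof.
exists [seq ord_pred i \in D | i <- enum 'I_n]; first by rewrite size_map size_enum_ord.
apply/setP => i; rewrite inE (nth_map i) ?size_enum_ord ?ltn_ord //.
by rewrite nth_ord_enum ordSK.
Qed.

(** * The cyclic descent map *)

Lemma count_image (T : finType) (S : eqType) (f : T -> S) (a : pred S) :
  count a [seq f x | x : T] = #|[pred x | a (f x)]|.
Proof. by rewrite /image_mem count_map enumT cardE size_filter. Qed.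

Section Main.
Variables (m k n : nat).
Hypotheses (hmk : m + 2 <= k) (hkn : k < n) (hk : 2 * k <= n + m).
Local Notation syt := (SYT n [:: n - k + m; k] [:: m]).

Let hkn' : k <= n. Proof. exact: ltnW. Qed.
Let hmk' : m <= k. Proof. lia. Qed.

Definition syt_word (T : syt) : n.-tuple bool := @word_of m k n (val T).

Lemma syt_wordP T :
  [/\ count id (syt_word T) = k, ballot m (syt_word T)
    & val T = word_tab (n - k + m) n m (syt_word T)].
Proof. exact: (word_of_sytP hkn' hmk' hk (valP T)). Qed.

Lemma card_SYT (X : pred bitseq) :
  #|[pred T : syt | X (syt_word T)]| =
  nwords n (fun w => [&& ballot m w, count id w == k & X w]).
Proof.
have inj : injective syt_word.
  move=> T T' e; apply: val_inj.
  by have [_ _ ->] := syt_wordP T; have [_ _ ->] := syt_wordP T'; rewrite e.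
rewrite -(card_image inj); apply: eq_card => w; rewrite inE.
apply/imageP/and3P => [[T XT ->]|[b /eqP cw Xw]].
  by have [-> ->] := syt_wordP T; rewrite eqxx.
have sw := size_tuple w.
pose T : syt := exist (fun T => @is_syt [:: n - k + m; k] [:: m] n T) _
  (is_syt_word_tab hkn' hmk' hk sw cw b).
have eT : syt_word T = w by apply: val_inj; exact: (word_of_word_tab hkn' hmk' hk).
by exists T; rewrite ?inE eT.
Qed.

Lemma cDesJ_word T : cDesJ T = bits_set n (ballot_cdes (rectify 0 (syt_word T))).
Proof.
have [cw b eT] := syt_wordP T; have sw := size_tuple (syt_word T).
have ft := fits_of_count hkn' hmk' hk sw cw.
rewrite /cDesJ eT.
have := jdt_word_tab b ft => ->.
have := b; rewrite -[m]add0n ballot_rectifyE cw => le.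
have le' := count_rectify_leq 0 (syt_word T); rewrite cw in le'.
by apply: cDes_word_tab; [split; rewrite ?size_rectify // [head _ _]/=; lia | lia].
Qed.

Lemma cDesJ_below_n (T : syt) : cDesJ T :&: below_n n = Des (val T).
Proof.
have [cw b eT] := syt_wordP T; have sw := size_tuple (syt_word T).
rewrite cDesJ_word eT (Des_word_tab (fits_of_count hkn' hmk' hk sw cw)).
apply/setP => i; rewrite !inE /= -(descents_rectify (syt_word T)).
have [lt|le] := ltnP i.+1 n.
  by rewrite andbT modn_small //= nth_behead.
have -> : i.+1 = n by have := ltn_ord i; lia.
by rewrite modnn andbF; case: (rectify _ _).
Qed.

Lemma cDesJ_shift :
  perm_eq [seq shift (cDesJ T) | T : syt] [seq cDesJ T | T : syt].
Proof.
have sizeE T : size (ballot_cdes (rectify 0 (syt_word T))) = n.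
rewrite /ballot_cdes [size (_ :: _)]/= size_behead size_descents size_rectify (size_tuple (syt_word T)).
  by rewrite prednK // (leq_ltn_trans _ hkn).
apply/seq.permP => a.
have : forall D, count_mem D [seq shift (cDesJ T) | T : syt] =
    count_mem D [seq cDesJ T | T : syt].
  move=> D; have [E sE <-] := bits_set_surj D; rewrite !count_image.
  have sE' : size (rotr 1 E) = n by rewrite size_rotr.
  transitivity #|[pred T : syt | ballot_cdes (rectify 0 (syt_word T)) == rot 1 E]|.
    apply: eq_card => T; rewrite !inE cDesJ_word shift_bits_set //.
    rewrite (inj_in_eq (@bits_set_inj n)) ?inE ?size_rotr ?sizeE ?sE //.
    by rewrite -[LHS](inj_eq (@rot_inj 1 _)) rotrK.
rewrite (card_SYT (fun w => ballot_cdes (rectify 0 w) == rot 1 E)) -nwords_skew_rot //.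
rewrite -(card_SYT (fun w => ballot_cdes (rectify 0 w) == E)).
  apply: eq_card => T; rewrite !inE cDesJ_word.
  by rewrite (inj_in_eq (@bits_set_inj n)) ?inE ?sizeE ?sE.
move=> e; move: a; apply/seq.permP; apply/allP => D _; exact/eqP/e.
Qed.
End Main.

Theorem theorem6p3 (m k n : nat)
    (hmk : 2 <= m + 2 <= k) (hkn : k < n) (hk : 2 * k <= n + m) :
  cyclic_descent_map (@cDesJ n [:: n - k + m; k] [:: m]).
Proof.
have /andP[_ hmk'] := hmk.
by split; [exact: cDesJ_below_n | exact: cDesJ_shift].
Qed.
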